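(* Let $X$ be a non-discrete metrizable space. For $n\in\mathbb{N}$, let $f:\mathbb{R}^{\binom{n}{2}}\to\mathbb{R}$ be a continuous function. If $f$ is positively sub-homogeneous, and if there exists a metric space not satisfying the $(n,f)$-metric inequality, then the set of all metrics $d\in\mathrm{Met}(X)$ for which the space $(X,d)$ does not satisfy the $(n,f)$-metric inequality is dense and open in $\mathrm{Met}(X)$.
   Context: For a metrizable space $X$, $\mathrm{Met}(X)$ denotes the set of all metrics on $X$ generating the topology of $X$, equipped with the topology generated by the $[0,\infty]$-valued metric $\mathcal{D}_X(d,e)=\sup_{(x,y)\in X^2}|d(x,y)-e(x,y)|$. $\mathbb{N}$ is the set of positive integers. Coordinates of $\mathbb{R}^{\binom{n}{2}}$ are indexed by unordered pairs $\{i,j\}$ of distinct elements of $\{1,\dots,n\}$. A metric space $(X,d)$ satisfies the $(n,f)$-metric inequality if for all $n$ points $a_1,\dots,a_n$ in $X$ we have $f(\{d(a_i,a_j)\}_{i\neq j})\ge 0$. A function $f:\mathbb{R}^{\binom{n}{2}}\to\mathbb{R}$ is positively sub-homogeneous if there exists $c\in(0,\infty)$ such that for every $x\in\mathbb{R}^{\binom{n}{2}}$ and every $r\in(0,\infty)$ we have $f(r\cdot x)\le r^{c}f(x)$. *)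

(* Defs.v *)
From HB Require Import structures.
From mathcomp Require Import all_boot all_order all_algebra.
From mathcomp Require Import all_classical all_reals all_analysis.

Set Implicit Arguments.
Unset Strict Implicit.
Unset Printing Implicit Defensive.

Import Order.TTheory GRing.Theory Num.Theory.
Import numFieldNormedType.Exports.

Local Open Scope classical_set_scope.
Local Open Scope ring_scope.

Definition is_metric (R : realType) (X : Type) (d : X -> X -> R) : Prop :=
  [/\ forall x y, 0 <= d x y,
      forall x y, d x y = 0 <-> x = y,
      forall x y, d x y = d y x
    & forall x y z, d x z <= d x y + d y z].

Definition generates_topology (R : realType) (X : topologicalType)
    (d : X -> X -> R) : Prop :=
  @nbhs X X = nbhs_ball_ (fun x (r : R) => [set y | d x y < r]).

Definition metrizable (R : realType) (X : topologicalType) : Prop :=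
  exists d : X -> X -> R, is_metric d /\ generates_topology d.

Record Met (R : realType) (X : topologicalType) : Type := mkMet {
  met_dist :> X -> X -> R;
  met_is_metric : is_metric met_dist;
  met_generates : generates_topology met_dist }.

Definition sup_dist (R : realType) (X : Type) (d e : X -> X -> R) : \bar R :=
  ereal_sup [set `|d p.1 p.2 - e p.1 p.2|%:E | p in [set: X * X]].

(* The topology of Met R X is the one generated by the balls of sup_dist. A
   pseudoMetricType is specified by its balls of finite radius, so it allows
   infinite distances. *)
Section Met_topology.
Context (R : realType) (X : topologicalType).

HB.instance Definition _ := gen_eqMixin (Met R X).
HB.instance Definition _ := gen_choiceMixin (Met R X).

Definition met_ball (d : Met R X) (r : R) : set (Met R X) :=
  [set e | (sup_dist d e < r%:E)%E].

Let met_ent : set_system (Met R X * Met R X) := entourage_ met_ball.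

Let met_nbhs (d : Met R X) : set_system (Met R X) := nbhs_ met_ent d.

Let met_nbhsE : met_nbhs = nbhs_ met_ent. Proof. by []. Qed.

HB.instance Definition _ := hasNbhs.Build (Met R X) met_nbhs.

Let met_ball_center d (r : R) : 0 < r -> met_ball d r d.
Proof.
move=> r0; rewrite /met_ball /=.
apply: (@le_lt_trans _ _ 0%E); last by rewrite lte_fin.
by apply: ge_ereal_sup => _ [p _ <-]; rewrite subrr normr0.
Qed.

Let met_ball_sym d e (r : R) : met_ball d r e -> met_ball e r d.
Proof.
rewrite /met_ball /=; congr (_ < _)%E; congr ereal_sup.
by apply: eq_imagel => p _; rewrite distrC.
Qed.

Let met_ball_triangle d e g (r s : R) :
  met_ball d r e -> met_ball e s g -> met_ball d (r + s) g.
Proof.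
rewrite /met_ball /= => de eg; rewrite EFinD.
apply: le_lt_trans (lteD de eg); apply: ge_ereal_sup => _ [p _ <-].
apply: (@le_trans _ _ (`|d p.1 p.2 - e p.1 p.2|%:E
                       + `|e p.1 p.2 - g p.1 p.2|%:E)%E).
  by rewrite -EFinD lee_fin ler_distD.
by apply: leeD; apply: ereal_sup_ubound; exists p.
Qed.

Let met_entE : met_ent = entourage_ met_ball. Proof. by []. Qed.

HB.instance Definition _ := @Nbhs_isPseudoMetric.Build R (Met R X)
  met_ent met_nbhsE met_ball met_ball_center met_ball_sym met_ball_triangle
  met_entE.

End Met_topology.

(* The unordered pair {i, j} is represented by (i, j) with i < j. *)
Definition upair (n : nat) : Type := {p : 'I_n * 'I_n | (p.1 < p.2)%N}.

(* R^(n choose 2), with the product topology. *)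
Notation pair_space R n := {ptws upair n -> R}.

Definition pair_dists (R : realType) (n : nat) (Y : Type) (d : Y -> Y -> R)
    (a : 'I_n -> Y) : pair_space R n :=
  fun p => d (a (val p).1) (a (val p).2).

(* The points a_1, ..., a_n need not be distinct. *)
Definition metric_inequality (R : realType) (n : nat) (f : pair_space R n -> R)
    (Y : Type) (d : Y -> Y -> R) : Prop :=
  forall a : 'I_n -> Y, 0 <= f (pair_dists d a).

Definition positively_subhomogeneous (R : realType) (n : nat)
    (f : pair_space R n -> R) : Prop :=
  exists2 c : R, 0 < c &
    forall (x : pair_space R n) (r : R), 0 < r ->
      f (fun p => r * x p) <= r `^ c * f x.

(* Main.v *)
Require Import Defs.
From mathcomp Require Import all_boot all_order all_algebra.
From mathcomp Require Import all_classical all_reals all_analysis.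
From mathcomp Require Import lra.
Set Implicit Arguments.
Unset Strict Implicit.
Unset Printing Implicit Defensive.
Import Order.TTheory GRing.Theory Num.Theory.
Import numFieldNormedType.Exports.
Local Open Scope classical_set_scope.
Local Open Scope ring_scope.

(** Failing the inequality means that some n points [a] give f a negative value
    on their distances. For fixed [a] these distances depend continuously on
    the metric, so the failure is an open condition.

    For density, let d be a metric on X, let eps > 0, and let b be n points of
    some metric space Y at which f is negative. Sub-homogeneity keeps f negative
    at all rescalings by r > 0 of the distances of b, so these distances may be
    taken smaller than eps. It remains to move d by less than eps so that some
    points p of X acquire exactly the rescaled distances D of b. Since X has a
    non-isolated point, p can be chosen so that the distances d (p i) (p j) are
    at most D i j, with p i and p j equal only when b i and b j are. The
    Kuratowski embedding of D into R^n with the sup norm then extends from the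
    points p to a map phi on X, Lipschitz with respect to d and with values in
    a cube of side sup D (McShane's formula); the maximum of d and the
    pseudometric pulled back along phi is the required metric. It lies between
    d and d + sup D, equals D on the points p because d is at most D there, and
    it is bi-Lipschitz equivalent to d, so it generates the same topology
    ([extend_finite_metric]). *)

(** * Metrics generating a topology *)

Lemma metricxx (R : realType) (X : Type) (d : X -> X -> R) :
  is_metric d -> forall x, d x x = 0.
Proof. by case=> _ d0 _ _ x; apply/d0. Qed.

Lemma generates_nbhsP (R : realType) (X : topologicalType) (d : X -> X -> R) :
  generates_topology d -> forall x A,
  nbhs x A <-> exists2 r, 0 < r & forall y, d x y < r -> A y.
Proof. by move=> dX x A; rewrite [nbhs x](congr1 (@^~ x) dX). Qed.

Lemma generates_topology_equivalent (R : realType) (X : topologicalType)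
    (d e : X -> X -> R) (K : R) :
    0 < K -> (forall x y, d x y <= e x y) ->
    (forall x y, e x y <= K * d x y) ->
  generates_topology d -> generates_topology e.
Proof.
move=> K0 de edK dX; rewrite /generates_topology dX; apply/funext => x.
apply/seteqP; split=> A [r r0 rA]; [exists r|exists (r / K)] => //=.
- by move=> y /= exy; apply: rA; apply: le_lt_trans exy.
- exact: divr_gt0.
- move=> y /=; rewrite ltr_pdivlMr // mulrC => dxy.
  exact/rA/(le_lt_trans (edK x y)).
Qed.

Lemma nondiscrete_small_distance (R : realType) (X : topologicalType)
    (d : X -> X -> R) : is_metric d -> generates_topology d ->
    ~ (forall A : set X, open A) ->
  exists x, forall r, 0 < r -> exists y, 0 < d x y < r.
Proof.
move=> dM dX nd; apply: contrapT => /forallNP iso; apply: nd => A.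
rewrite openE => x Ax; apply/(generates_nbhsP dX).
have /existsNP[r /not_implyP[r0 rx]] := iso x.
exists r => // y dxy; suff <- : x = y by [].
have [d0 dE _ _] := dM; apply/dE/eqP/negPn/negP => dn0.
by apply: rx; exists y; rewrite lt_neqAle eq_sym dn0 d0.
Qed.

(** Around a non-isolated point x, each term is chosen closer to x than the
    preceding one but distinct from x; the distances to x are then strictly
    decreasing, which forces the terms to be distinct. *)
Lemma injective_close_sequence (R : realType) (X : topologicalType)
    (d : X -> X -> R) : is_metric d -> generates_topology d ->
    ~ (forall A : set X, open A) ->
  forall r, 0 < r -> exists q : nat -> X,
    injective q /\ forall i j, d (q i) (q j) < r.
Proof.
move=> dM dX nd r r0.
have [x xP] := nondiscrete_small_distance dM dX nd.
have [g gP] : {g : R -> X & forall s, 0 < s -> 0 < d x (g s) < s}.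
  by apply: (@choice _ _ (fun s y => 0 < s -> 0 < d x y < s)) => s;
    case: (ltP 0 s) => [/xP[y]|_]; [exists y|exists x].
(* u k.+1 is the distance from x to the k-th chosen point g (u k). *)
pose u := fix u m := if m is k.+1 then d x (g (u k)) else r / 2.
have u0 m : 0 < u m by elim: m => [|m /gP/andP[]//]; rewrite divr_gt0.
have uS m : u m.+1 < u m by case/andP: (gP _ (u0 m)).
have ulo m k : (m < k)%N -> u k < u m.
  elim: k => // k IH; rewrite ltnS leq_eqVlt => /predU1P[->//|/IH].
  exact: lt_trans.
have ur m : u m.+1 < r / 2 by exact: (ulo 0%N).
exists (fun m => g (u m)); split=> [i j gij|i j].
  have uij : u i.+1 = u j.+1 by rewrite /= gij.
  have [/ulo|/ulo|[//]] := ltngtP i.+1 j.+1; first by rewrite uij ltxx.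
  by rewrite uij ltxx.
have [_ _ dC dT] := dM; apply: le_lt_trans (dT _ x _) _.
by rewrite [ltRHS]splitr dC ltrD // ur.
Qed.

(** * Extending a metric from finitely many points *)

(** McShane's formula for the largest L-Lipschitz function that is at most
    [v i] at each [p i], truncated from above at C. *)
Definition mcshane (R : realType) (X : Type) (d : X -> X -> R) (n : nat)
    (p : 'I_n -> X) (v : 'I_n -> R) (L C : R) (x : X) : R :=
  \big[Num.min/C]_i (v i + L * d x (p i)).

Lemma mcshane_bounds (R : realType) (X : Type) (d : X -> X -> R) (n : nat)
    (p : 'I_n -> X) (v : 'I_n -> R) (L C : R) (x : X) :
    is_metric d -> 0 <= L -> 0 <= C -> (forall i, 0 <= v i) ->
  0 <= mcshane d p v L C x <= C.
Proof.
move=> [d0 _ _ _] L0 C0 v0; rewrite bigmin_le_id andbT.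
by apply/bigmin_geP; split=> // i _; rewrite addr_ge0 // mulr_ge0.
Qed.

Lemma mcshane_lipschitz (R : realType) (X : Type) (d : X -> X -> R) (n : nat)
    (p : 'I_n -> X) (v : 'I_n -> R) (L C : R) (x y : X) :
    is_metric d -> 0 <= L ->
  `|mcshane d p v L C x - mcshane d p v L C y| <= L * d x y.
Proof.
move=> [d0 _ dC dT] L0.
have half a b : mcshane d p v L C a - L * d a b <= mcshane d p v L C b.
  apply/bigmin_geP; split=> [|i _].
    rewrite lerBlDr (le_trans (bigmin_le_id _ _ _ _)) // lerDl.
    exact: mulr_ge0.
  rewrite lerBlDr (le_trans (bigmin_le _ i _)) // -addrA lerD2l -mulrDr.
  by rewrite addrC ler_wpM2l.
by rewrite ler_distlC half /= -lerBlDr dC half.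
Qed.

Lemma mcshane_interpolates (R : realType) (X : Type) (d : X -> X -> R)
    (n : nat) (p : 'I_n -> X) (v : 'I_n -> R) (L C : R) (k : 'I_n) :
    is_metric d -> v k <= C ->
    (forall i, v k - v i <= L * d (p k) (p i)) ->
  mcshane d p v L C (p k) = v k.
Proof.
move=> dM vC vL; apply/le_anti/andP; split.
  by rewrite (le_trans (bigmin_le _ k _)) // metricxx // mulr0 addr0.
by apply/bigmin_geP; split=> // i _; rewrite -lerBlDl.
Qed.

(** The starting value [d x y] of the iterated maximum makes this the maximum of
    d and of the sup-norm pseudometric pulled back along [phi]. *)
Definition max_metric (R : realType) (X : Type) (d : X -> X -> R) (n : nat)
    (phi : 'I_n -> X -> R) (x y : X) : R :=
  \big[Num.max/d x y]_i `|phi i x - phi i y|.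

Lemma max_metric_is_metric (R : realType) (X : Type) (d : X -> X -> R)
    (n : nat) (phi : 'I_n -> X -> R) :
  is_metric d -> is_metric (max_metric d phi).
Proof.
move=> dM; have [d0 dE dC dT] := dM.
have ge x y : d x y <= max_metric d phi x y by exact: bigmax_ge_id.
split=> [x y|x y|x y|x y z].
- exact: le_trans (ge x y).
- split=> [e0|<-]; first by apply/dE/le_anti; rewrite d0 -e0 ge.
  apply/le_anti; rewrite (le_trans (d0 x x)) // andbT.
  by apply/bigmax_leP; rewrite metricxx //; split=> // i _; rewrite subrr normr0.
- by rewrite /max_metric dC; apply: eq_bigr => i _; rewrite distrC.
- apply/bigmax_leP; split=> [|i _].
    exact: le_trans (lerD (ge _ _) (ge _ _)).
  apply: le_trans (ler_distD (phi i y) _ _) _.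
  by apply: lerD; exact: le_bigmax.
Qed.

(** A quantitative form, for finite subsets, of Hausdorff's theorem on the
    extension of metrics. The [p i] may be repeated, so D is only a
    pseudometric on the indices. The bound of d by D on the points [p i] makes
    the value there of a maximum with d depend on D alone. *)
Lemma extend_finite_metric (R : realType) (X : topologicalType) (d : Met R X)
    (n : nat) (p : 'I_n -> X) (D : 'I_n -> 'I_n -> R) (C : R) :
    (forall i j, 0 <= D i j <= C) -> (forall i, D i i = 0) ->
    (forall i j, D i j = D j i) ->
    (forall i j k, D i k <= D i j + D j k) ->
    (forall i j, p i = p j -> D i j = 0) ->
    (forall i j, d (p i) (p j) <= D i j) -> 0 <= C ->
  exists e : Met R X, (sup_dist d e <= C%:E)%E /\
    forall i j, e (p i) (p j) = D i j.
Proof.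
move=> DC Dxx Dsym DT Dp dD C0.
have [dM dX] := (met_is_metric d, met_generates d).
have [d0 dE _ _] := dM.
have D0 i j : 0 <= D i j by case/andP: (DC i j).
(* L exceeds every ratio D i j / d (p i) (p j); the pairs with p i = p j
   contribute 0 since division by 0 gives 0. *)
pose L := \sum_(z : 'I_n * 'I_n) D z.1 z.2 / d (p z.1) (p z.2).
have term0 (z : 'I_n * 'I_n) : 0 <= D z.1 z.2 / d (p z.1) (p z.2).
  by rewrite divr_ge0.
have L0 : 0 <= L by exact: sumr_ge0.
have LP i j : D i j <= L * d (p i) (p j).
  have [/dE/Dp ->|pij] := eqVneq (d (p i) (p j)) 0; first exact: mulr_ge0.
  rewrite -ler_pdivrMr ?lt_neqAle 1?eq_sym ?pij ?d0 //.
  by rewrite /L (bigD1 (i, j)) //= lerDl sumr_ge0.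
(* The j-th Kuratowski coordinate: it extends the function k |-> D j k. *)
pose phi (j : 'I_n) := mcshane d p (D j) L C.
have phip j k : phi j (p k) = D j k.
  apply: mcshane_interpolates => // [|i]; first by case/andP: (DC j k).
  by rewrite lerBlDl (le_trans (DT j i k)) // lerD2l Dsym.
have phiL j x y : `|phi j x - phi j y| <= L * d x y.
  exact: mcshane_lipschitz.
have phiC j x y : `|phi j x - phi j y| <= C.
  have /andP[x0 xC] := mcshane_bounds p x dM L0 C0 (D0 j).
  have /andP[y0 yC] := mcshane_bounds p y dM L0 C0 (D0 j).
  by rewrite ler_norml -/(phi j) in x0 xC y0 yC *; apply/andP; split; lra.
pose e := max_metric d phi.
have de x y : d x y <= e x y by exact: bigmax_ge_id.
have edL x y : e x y <= (1 + L) * d x y.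
  rewrite mulrDl mul1r; apply/bigmax_leP; split=> [|j _].
    by rewrite lerDl mulr_ge0.
  by rewrite (le_trans (phiL j x y)) // lerDr.
have eX : generates_topology e.
  by apply: generates_topology_equivalent de edL dX; rewrite ltr_wpDr.
exists (mkMet (max_metric_is_metric _ dM) eX); split=> [|i j] /=.
  apply: ge_ereal_sup => _ [[x y] _ <-] /=.
  rewrite lee_fin distrC ger0_norm ?subr_ge0 // lerBlDr.
  apply/bigmax_leP; split=> [|k _]; first by rewrite lerDr.
  by rewrite (le_trans (phiC k x y)) // lerDl.
apply/le_anti/andP; split; last first.
  (* The j-th coordinate already separates p i and p j by D i j. *)
  by apply: (bigmax_sup j) => //; rewrite !phip Dxx subr0 Dsym ler_norm.
apply/bigmax_leP; split=> // k _; rewrite !phip.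
by rewrite ler_distlC DT andbT lerBlDr (Dsym i) DT.
Qed.

(** * Failure of the inequality is open and dense *)

Lemma eval_dists_continuous (R : realType) (X : topologicalType) (n : nat)
    (a : 'I_n -> X) :
  continuous (fun d : Met R X => pair_dists (n := n) d a).
Proof.
move=> d; apply/cvg_sup; first exact/fmap_filter/nbhs_filter.
(* The product topology is the supremum of the initial topologies of its
   projections, and convergence can be tested along a surjective projection. *)
move=> p.
have surj : [set g p | g in [set: pair_space R n]] = [set: R].
  by rewrite eqEsubset; split=> // r _; exists (fun=> r).
apply/cvg_image => //; first exact/fmap_filter/nbhs_filter.
apply: (@cvg_trans _ ((fun e : Met R X => pair_dists e a p) @ d)).
  move=> Q /= QN; exists ((fun g : pair_space R n => g p) @^-1` Q) => //.
  exact: image_preimage.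
suff : (fun e : Met R X => e (a (val p).1) (a (val p).2)) @ d -->
    d (a (val p).1) (a (val p).2) by [].
have dF : Filter (nbhs d) by exact: nbhs_filter.
apply/(cvgrPdist_lt (FF := dF)) => r r0.
apply: filterS (nbhsx_ballx d r r0) => e /=; rewrite /ball /= /met_ball /= => de.
rewrite -lte_fin; apply: le_lt_trans de; apply: ereal_sup_ubound.
by exists (a (val p).1, a (val p).2).
Qed.

Lemma fails_open (R : realType) (X : topologicalType) (n : nat)
    (f : pair_space R n -> R) :
  continuous f -> open [set d : Met R X | ~ metric_inequality f d].
Proof.
move=> fC; have -> : [set d : Met R X | ~ metric_inequality f d] =
    \bigcup_a [set d : Met R X | f (pair_dists d a) < 0].
  apply/seteqP; split=> d /=.
    by move=> /existsNP[a /negP]; rewrite -ltNge => fa; exists a.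
  by move=> [a _ fa] /(_ a); rewrite leNgt fa.
apply: bigcup_open => a _.
apply: (@open_comp _ _ (fun d : Met R X => f (pair_dists d a)) [set r | r < 0]).
  move=> d _; apply: (continuous_comp (f := fun d : Met R X => pair_dists d a)).
    exact: eval_dists_continuous.
  exact: fC.
exact: open_lt.
Qed.

(** A small rescaled copy of [b] is realized inside X by a metric near any
    given one; sub-homogeneity keeps f negative on the copy. *)
Lemma fails_dense (R : realType) (X : topologicalType) (n : nat)
    (f : pair_space R n -> R) (Y : metricType R) (b : 'I_n -> Y) :
    ~ (forall A : set X, open A) -> positively_subhomogeneous f ->
    f (pair_dists (@mdist R Y) b) < 0 ->
  dense [set d : Met R X | ~ metric_inequality f d].
Proof.
move=> X_nondiscrete f_subhom fb O [d Od] Oo.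
have [eps /= eps0 epsO] : nbhs_ball d O.
  by apply/nbhs_ballP; exact: open_nbhs_nbhs.
(* The summand 1 makes the bound M of the distances of b positive. *)
pose M := 1 + \sum_(z : 'I_n * 'I_n) mdist (b z.1) (b z.2).
have sM i j : mdist (b i) (b j) <= M.
  rewrite /M (bigD1 (i, j)) //= addrCA lerDl addr_ge0 // sumr_ge0 // => z _.
  exact: mdist_ge0.
have M0 : 0 < M.
  by rewrite ltr_pwDl // sumr_ge0 // => z _; exact: mdist_ge0.
pose r := eps / 2 / M.
have r0 : 0 < r by rewrite !divr_gt0.
pose D i j := r * mdist (b i) (b j).
(* The minimum over pairs of distinct points of b is positive, and every
   distance between the q i is below it. *)
have [q [qI qD]] : exists q : nat -> X, injective q /\
    forall i j, d (q i) (q j) <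
      \big[Num.min/1]_(z : 'I_n * 'I_n | b z.1 != b z.2) D z.1 z.2.
  apply: (injective_close_sequence (met_is_metric d) (met_generates d)) => //.
  by apply/bigmin_gtP; split=> // z bz; rewrite mulr_gt0 // mdist_gt0.
(* The first index of b i in the list of values of b depends only on b i, so
   repetitions in b become repetitions in p. *)
pose p i := q (index (b i) (codom b)).
have pb i j : p i = p j -> b i = b j.
  by move=> /qI/(index_inj (b i)); apply; exact: codom_f.
have [e [de eD]] : exists e : Met R X, (sup_dist d e <= (eps / 2)%:E)%E /\
    forall i j, e (p i) (p j) = D i j.
  apply: extend_finite_metric.
  - move=> i j; rewrite mulr_ge0 ?mdist_ge0 ?(ltW r0) //=.
    rewrite /D /r -mulrA ler_piMr ?divr_ge0 ?(ltW eps0) //.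
    by rewrite mulrC ler_pdivrMr ?mul1r.
  - by move=> i; rewrite /D mdistxx mulr0.
  - by move=> i j; rewrite /D metric_sym.
  - by move=> i j k; rewrite /D -mulrDr ler_pM2l // metric_triangle.
  - by move=> i j /pb; rewrite /D => ->; rewrite mdistxx mulr0.
  - move=> i j; have [bij|bij] := eqVneq (b i) (b j).
      have [d0 dE _ _] := met_is_metric d.
      have -> : d (p i) (p j) = 0 by apply/dE; rewrite /p bij.
      by rewrite mulr_ge0 ?mdist_ge0 ?(ltW r0).
    apply/ltW/(lt_le_trans (qD _ _)).
    exact: (@bigmin_le_cond _ _ _ _ (i, j)).
  - by rewrite divr_ge0 // ltW.
exists e; split=> [|/(_ p)]; last apply/negP.
  apply: epsO; rewrite /ball /= /met_ball /=; apply: le_lt_trans de _.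
  by rewrite lte_fin ltr_pdivrMr // ltr_pMr // ltr1n.
have [c c0 fc] := f_subhom.
have -> : pair_dists e p = fun z => r * pair_dists (@mdist R Y) b z.
  by apply/funext => z; rewrite /pair_dists eD.
rewrite -ltNge; apply: le_lt_trans (fc _ _ r0) _.
by rewrite pmulr_rlt0 // powR_gt0.
Qed.

Theorem corollary4p17 (R : realType) (X : topologicalType)
  (X_metrizable : metrizable R X)
  (X_nondiscrete : ~ (forall A : set X, open A))
  (n : nat) (n_gt0 : (0 < n)%N)
  (f : pair_space R n -> R) (f_cont : continuous f)
  (f_subhom : positively_subhomogeneous f)
  (f_fails : exists Y : metricType R, ~ metric_inequality f (@mdist R Y)) :
  dense [set d : Met R X | ~ metric_inequality f d] /\
  open [set d : Met R X | ~ metric_inequality f d].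
Proof.
split; last exact: fails_open.
have [Y /existsNP[b /negP]] := f_fails; rewrite -ltNge => fb.
exact (fails_dense X_nondiscrete f_subhom fb).
Qed.
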